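(* Let $V$ be an elementary abelian $2$-group and let $\mathcal{K}_V=\{K_W,\ W \text{ a subgroup of } V\}$ be a Gysin-$V$-functor. Write $d(K_0)=\sum_{i\ge 0}\dim_{\mathbb{F}_2}(K_0)^i$, where $K_0=\mathcal{K}_V(0)$ is the value at the trivial subgroup. Then: (i) If $\mathrm{rk}(V)=1$, then $d(K_0)\ge 2$. (ii) If $\mathrm{rk}(V)=2$ and $\mathcal{K}_V$ is connected, then $d(K_0)\ge 4$. (iii) If $\mathrm{rk}(V)=3$ and $\mathcal{K}_V$ is bi-connected, then $d(K_0)\ge 8$.
   Context: An elementary abelian $2$-group $V$ of rank $d=\mathrm{rk}(V)$ is a group isomorphic to $(\mathbb{Z}/2\mathbb{Z})^d$. $H^*V$ denotes its mod $2$ cohomology algebra, a polynomial $\mathbb{F}_2$-algebra on $d$ generators of degree one (equal to $\mathbb{F}_2$ if $d=0$). Gradings are by the non-negative integers; a graded $\mathbb{F}_2$-vector space is finite if its total dimension is finite. Let $\mathbb{K}_f$ be the category of graded, finite, unitary $\mathbb{F}_2$-algebras (morphisms: graded unitary algebra maps). An object of $H^*W$-$\mathbb{K}_f$ is an object $K$ of $\mathbb{K}_f$ equipped with an $H^*W$-module structure $H^*W\otimes K\to K$ which is a map of graded unitary $\mathbb{F}_2$-algebras. A Gysin-$V$-functor is a contravariant functor $\mathcal{K}_V$, $W\mapsto \mathcal{K}_V(W)=K_W$, from the poset of subgroups of $V$ (ordered by inclusion, viewed as a category) to $\mathbb{K}_f$ such that: (1) for every subgroup $W$ of $V$, $K_W$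 is a non-trivial (nonzero) object of $H^*W$-$\mathbb{K}_f$; (2) for every subgroup $W$ of $V$ and every subgroup $U$ of $W$ of codimension one, with inclusion $i:U\hookrightarrow W$, there is an exact sequence of $H^*W$-modules $$\cdots\to (K_W)^{*-1}\xrightarrow{\ t\cdot\ }(K_W)^*\xrightarrow{\ \mathcal{K}_V(i)\ }(K_U)^*\xrightarrow{\ \psi\ }(K_W)^*\xrightarrow{\ t\cdot\ }(K_W)^{*+1}\to\cdots$$ where $K_U$ is an $H^*W$-algebra via $i^*:H^*W\to H^*U$, $H^*(W/U)\cong\mathbb{F}_2[t]$ with $t$ of degree one, and $t\cdot$ is the action of $t$ on $K_W$ via the map $\pi^*:H^*(W/U)\to H^*W$ induced by the projection $\pi:W\to W/U$. For a finite graded $\mathbb{F}_2$-vector space $E$, the norm $\|E\|$ is $\max\{k\in\mathbb{N}: E^k\ne 0\}$. $E$ is connected if $E^0\cong\mathbb{Z}/2\mathbb{Z}$, and bi-connected if $E^0\cong\mathbb{Z}/2\mathbb{Z}$ and $E^{\|E\|}\cong\mathbb{Z}/2\mathbb{Z}$. The Gysin-$V$-functor $\mathcal{K}_V$ is connected (resp. bi-connected) if $K_0$ is connected (resp. bi-connected). *)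

(* Defs.v *)
From HB Require Import structures.
From mathcomp Require Import all_boot all_order all_algebra.
From mathcomp Require Import all_fingroup all_solvable all_field all_character.
From mathcomp Require Import mpoly.

Set Implicit Arguments.
Unset Strict Implicit.
Unset Printing Implicit Defensive.

Import GRing.Theory.
Local Open Scope ring_scope.

(** * Mod 2 cohomology of elementary abelian 2-groups

    For an elementary abelian 2-group G, H^1 G = Hom(G, F_2), and H^*G is the
    symmetric algebra of H^1 G, graded by polynomial degree.  It is represented
    by polynomials in the elements of a fixed basis of H^1 G; [cohom_class] and
    [cohom_map] do not depend on this basis (see [cohom_mapE]). *)

(* Homomorphisms G -> F_2, extended by 0 outside G: distinct elements are
   distinct homomorphisms. *)
Definition is_dual (gT : finGroupType) (G : {set gT}) (l : {ffun gT -> 'F_2}) :=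
  [forall x, (x \notin G) ==> (l x == 0)] &&
  [forall x in G, forall y in G, l (x * y)%g == l x + l y].

Definition H1 (gT : finGroupType) (G : {set gT}) : {vspace {ffun gT -> ('F_2)^o}} :=
  <<([seq l <- enum {ffun gT -> 'F_2} | is_dual G l] :
     seq {ffun gT -> ('F_2)^o})>>%VS.

Definition cohom (gT : finGroupType) (G : {set gT}) := {mpoly 'F_2[\dim (H1 G)]}.

Definition cohom_class (gT : finGroupType) (G : {set gT})
    (l : {ffun gT -> ('F_2)^o}) : cohom G :=
  \sum_(i < \dim (H1 G)) coord (vbasis (H1 G)) i l *: 'X_i.

(* For f a homomorphism from G to H; the condition x \in G only enforces the
   convention that dual elements vanish outside G. *)
Definition dual_map (aT rT : finGroupType) (G : {set aT}) (f : aT -> rT)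
    (l : {ffun rT -> ('F_2)^o}) : {ffun aT -> ('F_2)^o} :=
  [ffun x => if x \in G then l (f x) else 0].

Definition cohom_map (aT rT : finGroupType) (G : {set aT}) (H : {set rT})
    (f : aT -> rT) (h : cohom H) : cohom G :=
  h \mPo [tuple cohom_class G (dual_map G f (vbasis (H1 H))`_i)
             | i < \dim (H1 H)].

Lemma is_dualP (gT : finGroupType) (G : {set gT}) (l : {ffun gT -> 'F_2}) :
  reflect ((forall x, x \notin G -> l x = 0) /\
           {in G &, forall x y, l (x * y)%g = l x + l y})
          (is_dual G l).
Proof.
apply: (iffP andP) => [[/forallP l0 /forall_inP lM]|[l0 lM]]; split.
- by move=> x xG; apply/eqP/(implyP (l0 x)).
- by move=> x y xG yG; apply/eqP/(forall_inP (lM x xG)).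
- by apply/forallP => x; apply/implyP => /l0 ->.
- by apply/forall_inP => x xG; apply/forall_inP => y yG; rewrite lM.
Qed.

Lemma mem_H1 (gT : finGroupType) (G : {set gT}) (l : {ffun gT -> ('F_2)^o}) :
  (l \in H1 G) = is_dual G l.
Proof.
apply/idP/idP => [|lG]; last first.
  apply: memv_span; by rewrite mem_filter lG mem_enum.
pose s : seq {ffun gT -> ('F_2)^o} :=
  [seq l <- enum {ffun gT -> 'F_2} | is_dual G l].
move=> /(coord_span (X := in_tuple s)) ->.
apply: (big_ind (fun u : {ffun gT -> ('F_2)^o} => is_dual G u)) => [|u v /is_dualP[u0 uM] /is_dualP[v0 vM]|i _].
- by apply/is_dualP; split => [x|x y] *; rewrite !ffunE ?addr0.
- apply/is_dualP; split => [x xG|x y xG yG].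
    by rewrite ffunE u0 // v0 // addr0.
  by rewrite !ffunE uM // vM // addrACA.
have : s`_i \in s by apply: mem_nth; apply: ltn_ord.
rewrite mem_filter => /andP[/is_dualP[m0 mM] _].
apply/is_dualP; split => [x xG|x y xG yG].
  by rewrite ffunE m0 // scaler0.
by rewrite !ffunE mM // scalerDr.
Qed.

Lemma dim_H1 (gT : finGroupType) (G : {group gT}) :
  (2.-abelem G)%g -> \dim (H1 G) = 'r(G)%g.
Proof.
move=> abG; have [G1|ntG] := eqVneq (G : {set gT}) 1%g.
  rewrite G1 rank1; apply/eqP; rewrite dimv_eq0; apply/eqP/vspaceP => l.
  rewrite mem_H1 memv0; apply/is_dualP/eqP => [[l0 lM]|->]; last first.
    by split => [x|x y] *; rewrite !ffunE ?addr0.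
  apply/ffunP => x; rewrite ffunE; have [|/l0//] := boolP (x \in [1 gT]%g).
  move=> /set1P ->; have := lM 1%g 1%g (set11 _) (set11 _).
  by rewrite mulg1 => /eqP; rewrite -subr_eq subrr eq_sym => /eqP.
rewrite (rank_abelem abG) -(dim_abelemE abG ntG).
set n := ('dim G)%g.
pose phi (c : 'cV['F_2]_n) : {ffun gT -> ('F_2)^o} :=
  [ffun x => if x \in G then (abelem_rV abG ntG x *m c) 0 0 else 0].
have phi_lin : linear phi.
  move=> a u v; apply/ffunP => x; rewrite !ffunE; case: ifP => _.
    by rewrite mulmxDr -scalemxAr !mxE.
  by rewrite scaler0 addr0.
pose phiL := GRing.isLinear.Build _ _ _ _ phi phi_lin.
pose Phi : {linear _ -> _} := HB.pack phi phiL.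
have phi_inj : lker (linfun Phi) == 0%VS.
  rewrite -subv0; apply/subvP => c; rewrite memv_ker lfunE memv0 /= => /eqP c0.
  apply/eqP/matrixP => i j; rewrite [j]ord1 mxE.
  have := congr1 (fun f : {ffun gT -> ('F_2)^o} =>
     f (rVabelem abG ntG (delta_mx 0 i))) c0.
  by rewrite !ffunE mem_rVabelem rVabelemK -rowE mxE.
have -> : H1 G = limg (linfun Phi).
  apply/vspaceP => l; rewrite mem_H1; apply/is_dualP/memv_imgP.
    move=> [l0 lM]; exists (\col_i l (rVabelem abG ntG (delta_mx 0 i))).
      exact: memvf.
    rewrite lfunE; apply/ffunP => x; rewrite ffunE.
    case: ifPn => [xG|/l0//].
    rewrite -{1}(abelem_rV_K abG ntG xG); move: (abelem_rV _ _ _) => v.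
    have lD : {morph (fun v => l (rVabelem abG ntG v)) : u v / u + v}.
      by move=> u w /=; rewrite rVabelemD lM // mem_rVabelem.
    have lZ (a : 'F_2) u : l (rVabelem abG ntG (a *: u)) =
       a * l (rVabelem abG ntG u).
      have l10 : l (rVabelem abG ntG 0) = 0.
        by have := lD 0 0; rewrite /= addr0 => /eqP;
           rewrite -subr_eq subrr eq_sym => /eqP.
      case: a => [[|[|//]] a2].
        have -> : Ordinal a2 = 0 :> 'F_2 by apply: val_inj.
        by rewrite scale0r mul0r.
      have -> : Ordinal a2 = 1 :> 'F_2 by apply: val_inj.
      by rewrite scale1r mul1r.
    rewrite {1}(row_sum_delta v) mxE.
    have l10 : l (rVabelem abG ntG 0) = 0.
      by have := lZ 0 0; rewrite scale0r mul0r.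
    rewrite (big_morph (fun v => l (rVabelem abG ntG v)) lD l10).
    by apply: eq_bigr => i _; rewrite lZ mxE.
  move=> [c _ ->]; rewrite lfunE; split => [x /negPf xG|x y xG yG].
    by rewrite ffunE xG.
  rewrite !ffunE xG yG groupM //.
  by rewrite (morphM (abelem_rV_morphism abG ntG)) // mulmxDl mxE.
rewrite limg_dim_eq ?dimvf ?(eqP phi_inj) ?capv0 //.
by rewrite /dim /= muln1.
Qed.

Lemma cohom_mapE (aT rT : finGroupType) (G : {group aT}) (H : {group rT})
    (f : aT -> rT) (l : {ffun rT -> ('F_2)^o}) :
    l \in H1 H ->
  cohom_map G f (cohom_class H l) = cohom_class G (dual_map G f l).
Proof.
move=> lH; rewrite /cohom_map {1}/cohom_class raddf_sum /=.
transitivity (\sum_(i < \dim (H1 H)) coord (vbasis (H1 H)) i l *: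
    cohom_class G (dual_map G f (vbasis (H1 H))`_i)).
  apply: eq_bigr => i _; rewrite comp_mpolyZ comp_mpolyXU; congr (_ *: _).
  by rewrite -tnth_nth tnth_mktuple.
have -> : dual_map G f l = \sum_(i < \dim (H1 H)) coord (vbasis (H1 H)) i l *:
    dual_map G f (vbasis (H1 H))`_i.
  apply/ffunP => x; rewrite sum_ffunE ffunE.
  rewrite {1}(coord_vbasis lH) sum_ffunE.
  case: ifP => xG; last by rewrite big1 // => i _; rewrite !ffunE xG scaler0.
  by apply: eq_bigr => i _; rewrite !ffunE xG.
rewrite [RHS]/cohom_class.
under [RHS]eq_bigr => j _ do rewrite linear_sum /= scaler_suml.
rewrite exchange_big /=; apply: eq_bigr => i _.
rewrite /cohom_class scaler_sumr; apply: eq_bigr => j _.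
by rewrite scalerA linearZ.
Qed.

(** * Graded finite algebras *)

(* [gr_bound] is an arbitrary bound on the nonzero degrees.  As a [falgType],
   the underlying algebra is finite-dimensional over F_2, associative and
   unitary, and it is nonzero. *)
Structure gralg := Gralg {
  gr_sort :> falgType 'F_2;
  gr : nat -> {vspace gr_sort};
  gr_bound : nat;
  gr_big : forall n, (gr_bound <= n)%N -> gr n = 0%VS;
  gr_full : (\sum_(n < gr_bound) gr n)%VS = fullv;
  gr_direct : directv (\sum_(n < gr_bound) gr n);
  gr_one : 1 \in gr 0;
  gr_mul : forall m n (x y : gr_sort),
    x \in gr m -> y \in gr n -> x * y \in gr (m + n)%N
}.

Definition total_dim (K : gralg) : nat :=
  (\sum_(n < gr_bound K) \dim (gr K n))%N.

Definition gr_norm (K : gralg) : nat :=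
  (\max_(n < gr_bound K | gr K n != 0%VS) n)%N.

Definition connected (K : gralg) : Prop := \dim (gr K 0) = 1%N.

Definition biconnected (K : gralg) : Prop :=
  \dim (gr K 0) = 1%N /\ \dim (gr K (gr_norm K)) = 1%N.

Definition homogeneous (K L : gralg) (f : K -> L) : Prop :=
  forall n x, x \in gr K n -> f x \in gr L n.

(* K^(n-1), with K^(-1) = 0. *)
Definition gr_pred (K : gralg) (n : nat) : {vspace K} :=
  if n is m.+1 then gr K m else 0%VS.

(** * H^*W-algebras *)

(* The action H^*W (x) K -> K is given as a bilinear map; [co_actM] and [co_act1]
   say that it is a map of unitary algebras, [co_act_gr] that it is graded. *)
Structure cohom_alg (gT : finGroupType) (W : {group gT}) := CohomAlg {
  co_alg :> gralg;
  co_act : cohom W -> co_alg -> co_alg;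
  co_act_linearl : forall x, linear (co_act^~ x);
  co_act_linearr : forall h, linear (co_act h);
  co_act1 : forall x, co_act 1 x = x;
  co_actA : forall h h' x, co_act (h * h') x = co_act h (co_act h' x);
  co_actM : forall h h' x x',
    co_act (h * h') (x * x') = co_act h x * co_act h' x';
  co_act_gr : forall m n h x,
    h \is m.-homog -> x \in gr co_alg n -> co_act h x \in gr co_alg (m + n)%N
}.

(** * Gysin functors *)

(* [t] is the image under pi^* of the generator of H^*(W/U) = F_2[t]. *)
Definition gysin_exact (gT : finGroupType) (W U : {group gT})
    (KW : cohom_alg W) (KU : cohom_alg U) (t : cohom W)
    (res : KW -> KU) (psi : KU -> KW) : Prop :=
  [/\ (* at the first K_W *)
      forall n (x : KW), x \in gr KW n ->
        (res x = 0 <-> exists2 y, y \in gr_pred KW n & x = co_act t y),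
      (* at K_U *)
      forall n (x : KU), x \in gr KU n ->
        (psi x = 0 <-> exists2 y, y \in gr KW n & x = res y)
    & (* at the second K_W *)
      forall n (x : KW), x \in gr KW n ->
        (co_act t x = 0 <-> exists2 y, y \in gr KU n & x = psi y)].

Definition gysin_sequence (gT : finGroupType) (W U : {group gT})
    (KW : cohom_alg W) (KU : cohom_alg U) (res : KW -> KU) : Prop :=
  exists t : cohom (W / U)%G, exists psi : {linear KU -> KW},
    [/\ t \is 1.-homog /\ t != 0,
        homogeneous psi,
        forall (h : cohom W) x,
          res (co_act h x) = co_act (cohom_map U id h) (res x),
        forall (h : cohom W) x,
          psi (co_act (cohom_map U id h) x) = co_act h (psi x)
      & gysin_exact (cohom_map W (coset U) t) res psi].

(* The elementary abelian group V is the whole group [set: gT], so that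
   {group gT} is the set of all its subgroups.  That each K_W is nonzero is
   part of [gralg]. *)
Structure gysin_functor (gT : finGroupType) := GysinFunctor {
  gy_obj :> forall W : {group gT}, cohom_alg W;
  gy_res : forall W U : {group gT}, U \subset W ->
    {lrmorphism gy_obj W -> gy_obj U};
  gy_res_gr : forall (W U : {group gT}) (sUW : U \subset W),
    homogeneous (gy_res sUW);
  gy_res_id : forall (W : {group gT}) (sWW : W \subset W) x,
    gy_res sWW x = x;
  gy_res_comp : forall (W U T : {group gT})
      (sUW : U \subset W) (sTU : T \subset U) (sTW : T \subset W) x,
    gy_res sTU (gy_res sUW x) = gy_res sTW x;
  gy_exact : forall (W U : {group gT}) (sUW : U \subset W),
    #|W : U|%g = 2%N -> gysin_sequence (gy_res sUW)
}.

(* Main.v *)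
Require Import Defs.
From mathcomp Require Import all_boot all_order all_algebra.
From mathcomp Require Import all_fingroup all_solvable all_field all_character.
From mathcomp Require Import mpoly zify.

(** Along a chain [1 < U < W < V] of subgroups of index two, write
    [A = K_V], [B = K_W], [C = K_U], [D = K_1], and let [z], [x], [t] be the
    degree one classes that appear in the Gysin sequences of [W < V], [U < W],
    [1 < U].  A class [y] of [B] lifts [t], because linear forms on [U] extend to
    [W].  All these classes are nilpotent.

    A Gysin sequence cuts [D] into a cokernel and a kernel of [t] on [C], which
    have the same dimension, so [dim D = 2 g] with [g = dim (ker t)]
    ([gysin_pair_dim]).  In rank one, [g >= 1] by nilpotency.

    In rank two, let [X] be the image of [B] in [C], and let the socle of [B] be
    the common kernel of [x] and [y].  The quotient [C / X] is the kernel of [x]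
    on [B], on which [t] acts as [y].  Comparing kernel and cokernel of [t] there
    gives [dim (socle B) = dim C - dim (X + t C)] ([dim_socle]).  Since [X]
    contains [1] and [t C] does not, [g > dim (socle B) >= 1].

    In rank three, let [M] be the image of [A] in [B], a subalgebra containing
    [x] and [y].  The socle of [B] contains a nonzero monomial [s] in [x] and
    [y], which lies in [M], and a class [psi w] of top degree outside [M].  Hence
    [g >= 3], and it remains to exclude [g = 3].  In that case the socle is
    spanned by [s] and [psi w], where [psi : C -> B] is the Gysin map, and
    [X + t C = F + t C], with [F] the line of [1].  Write [s = psi c]; then [t c] is the restriction of some [beta] in [B],
    and [B = M + M beta] ([rank_three_generators]).  As [dim B = 2 dim M], this
    sum is direct and [m |-> m beta] is injective on [M] ([amulr_lreg]).  Let
    [y ^ e.+1] be the first power of [y] in [x B].  Then [t ^ e.+1 = 0] in [C]; as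
    [t] acts by multiplication by an element of the ring [C], it follows that
    [t ^ e (t c) = 0].  So [y ^ e beta] lies in [x B], and freeness of [B] on [1]
    and [beta] puts [y ^ e] in [x B], against the choice of [e]
    ([rank_three_dim_gt]). *)

Set Implicit Arguments.
Unset Strict Implicit.
Unset Printing Implicit Defensive.

Import GRing.Theory.

(** * Nilpotent elements of a finite-dimensional algebra *)

Section Nilpotent.
Local Open Scope ring_scope.
Variables (F : fieldType) (B : falgType F).
Implicit Types (x y b : B) (U : {vspace B}).

Lemma amullE x b : amull x b = x * b.
Proof. by rewrite lfunE. Qed.

Lemma amulrE x b : amulr x b = b * x.
Proof. by rewrite lfunE. Qed.

Lemma nilpotent_mul_neq1 x b n : x ^+ n = 0 -> x * b != 1.
Proof.
move=> xn; apply/eqP => xb1.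
have xbk k : x ^+ k * b ^+ k = 1.
  elim: k => [|k IHk]; first by rewrite !expr0 mulr1.
  by rewrite exprSr exprS mulrA -(mulrA _ x) xb1 mulr1.
by have /eqP := xbk n; rewrite xn mul0r eq_sym oner_eq0.
Qed.

(** Iterating [b \in U + x B] gives [b \in U + x ^ k B] for all [k]. *)
Lemma nilpotent_nakayama x n U :
    x ^+ n = 0 -> {in U, forall u, x * u \in U} ->
    (forall b, exists2 u, u \in U & exists b', b = u + x * b') ->
  forall b, b \in U.
Proof.
move=> xn xU UxB b.
have [u uU] : exists2 u, u \in U & exists b', b = u + x ^+ n * b'.
  elim: n {xn} => [|k [u uU [b' ->]]].
    by exists 0; [exact: mem0v | exists b; rewrite add0r expr0 mul1r].
  have [v vU [b'' ->]] := UxB b'.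
  exists (u + x ^+ k * v).
    apply: memvD => //; elim: k {uU} => [|k IHk]; first by rewrite expr0 mul1r.
    by rewrite exprS -mulrA; apply: xU.
  by exists b''; rewrite exprSr mulrDr !mulrA addrA.
by case=> b' ->; rewrite xn mul0r addr0.
Qed.

Lemma last_nonzero_power x b n :
  x ^+ n = 0 -> b != 0 -> exists k, x ^+ k * b != 0 /\ x * (x ^+ k * b) = 0.
Proof.
move=> xn b0; have: exists k, x ^+ k * b == 0 by exists n; rewrite xn mul0r.
move/ex_minnP => [[|k] /eqP xk kmin].
  by rewrite expr0 mul1r in xk; rewrite xk eqxx in b0.
exists k; split; last by rewrite mulrA -exprS.
by apply/negP => /kmin; rewrite ltnn.
Qed.

Lemma nilpotent_dim_lt x n U :
  x ^+ n = 0 -> 1 \in U -> (\dim (limg (amull x)) < \dim (U + limg (amull x))%VS)%N.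
Proof.
move=> xn U1; rewrite (ltn_leqif (dimv_leqif_sup (addvSr _ _))).
apply/negP => /subvP sUx.
have /sUx/memv_imgP[b _ /esym/eqP] : 1 \in (U + limg (amull x))%VS.
  exact: (subvP (addvSl _ _)).
by rewrite amullE (negPf (nilpotent_mul_neq1 b xn)).
Qed.

Definition socle x y : {vspace B} := (lker (amull x) :&: lker (amull y))%VS.

Lemma memv_socle x y b : (b \in socle x y) = (x * b == 0) && (y * b == 0).
Proof. by rewrite memv_cap !memv_ker !amullE. Qed.

(** Raise [x], then [y], to the last power that keeps the product nonzero. *)
Lemma socle_monomial x y n : x * y = y * x -> x ^+ n = 0 -> y ^+ n = 0 ->
  exists i k, y ^+ k * x ^+ i != 0 /\ y ^+ k * x ^+ i \in socle x y.
Proof.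
move=> xyC xn yn; have [i] := last_nonzero_power xn (oner_neq0 B).
rewrite mulr1 => -[xi xxi]; have [k [yk yyk]] := last_nonzero_power yn xi.
exists i, k; split=> //; rewrite memv_socle yyk eqxx andbT mulrA.
have -> : x * y ^+ k = y ^+ k * x by apply: commrX.
by rewrite -mulrA xxi mulr0.
Qed.

End Nilpotent.

(** * Gysin sequences without gradings *)

Section GysinPair.
Local Open Scope ring_scope.
Variable F : fieldType.

Definition gysin_pair (B C : falgType F) (r : 'AHom(B, C)) (x : B)
    (psi : 'Hom(C, B)) : Prop :=
  [/\ forall b, r b = 0 <-> exists b', b = x * b',
      forall c, psi c = 0 <-> exists b, c = r b
    & forall b, x * b = 0 <-> exists c, b = psi c].

Variables (B C : falgType F) (r : 'AHom(B, C)) (x : B)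
  (psi : 'Hom(C, B)).
Hypothesis exBC : gysin_pair r x psi.

Lemma gysin_pair_lker : lker r = limg (amull x).
Proof.
case: exBC => exB _ _; apply/vspaceP => b; rewrite memv_ker.
apply/eqP/memv_imgP => [/exB[b' ->]|[b' _ ->]].
  by exists b'; rewrite ?memvf ?amullE.
by apply/exB; exists b'; rewrite -amullE.
Qed.

Lemma gysin_pair_lker_psi : lker psi = limg r.
Proof.
case: exBC => _ exC _; apply/vspaceP => b; rewrite memv_ker.
apply/eqP/memv_imgP => [/exC[b' ->]|[b' _ ->]].
  by exists b'; rewrite ?memvf.
by apply/exC; exists b'.
Qed.

Lemma gysin_pair_limg_psi : limg psi = lker (amull x).
Proof.
case: exBC => _ _ exB; apply/vspaceP => b; rewrite memv_ker amullE.
apply/memv_imgP/eqP => [[c _ ->]|/exB[c ->]].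
  by apply/exB; exists c.
by exists c; rewrite ?memvf.
Qed.

(** Both halves of [C] have dimension [dim (ker x) = dim (B / x B)]. *)
Lemma gysin_pair_dim :
  \dim {:C} = (2 * \dim (limg r))%N /\
  \dim {:C} = (2 * \dim (lker (amull x)))%N.
Proof.
have := limg_ker_dim psi fullv; have := limg_ker_dim r fullv.
have := limg_ker_dim (amull x) fullv.
rewrite !capfv gysin_pair_lker gysin_pair_lker_psi gysin_pair_limg_psi; lia.
Qed.

Variable y : B.
Hypothesis psiM : forall c, psi (r y * c) = y * psi c.

(** [P] is the set of [c] whose class in [C / X] is killed by [t = r y], so [P / X]
    is the kernel of [t] on [C / X], which has the dimension of the cokernel
    [C / (X + t C)].  The map [psi] identifies [P / X] with the socle. *)
Lemma dim_socle :
  (\dim (socle x y) +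
     \dim (limg r + limg (amull (r y)))%VS = \dim {:C})%N.
Proof.
set X := limg r; set T := amull (r y).
pose P := (T @^-1: X)%VS.
have memP c : (c \in P) = (r y * c \in X) by rewrite -memv_preim amullE.
have sXP : (X <= P)%VS.
  apply/subvP => _ /memv_imgP[b _ ->]; by rewrite memP -rmorphM memv_img ?memvf.
have sKP : (lker T <= P)%VS.
  apply/subvP => c; rewrite memv_ker memP amullE => /eqP->; exact: mem0v.
have psiP : (psi @: P)%VS = socle x y.
  have memX c : (c \in X) = (psi c == 0).
    by rewrite /X -gysin_pair_lker_psi memv_ker.
  apply/vspaceP => b; rewrite memv_socle; apply/memv_imgP/andP.
    case=> c; rewrite memP memX psiM => yc ->; split=> //.
    by case: exBC => _ _ exB; apply/eqP/exB; exists c.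
  case: exBC => _ _ exB [/eqP/exB[c ->]] yc.
  by exists c; rewrite // memP memX psiM.
have TP : (T @: P)%VS = (X :&: limg T)%VS.
  apply/vspaceP => c; rewrite memv_cap; apply/memv_imgP/andP.
    case=> c' Pc' ->; split; last by rewrite memv_img ?memvf.
    by rewrite amullE -memP.
  by case=> Xc /memv_imgP[c' _ def_c]; exists c' => //; rewrite memP -amullE -def_c.
have := limg_ker_dim T P; have := limg_ker_dim psi P.
have := limg_ker_dim T fullv; have := dimv_sum_cap X (limg T).
rewrite capfv psiP TP gysin_pair_lker_psi (capv_idPr sXP) (capv_idPr sKP); lia.
Qed.

(** By [dim_socle], the socle has the dimension of [C / (X + t C)], a proper
    quotient of [C / t C] since the unit lies in [X] and not in [t C]. *)
Lemma dim_socle_lt n :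
  r y ^+ n = 0 -> (\dim (socle x y) < \dim (lker (amull (r y))))%N.
Proof.
move=> tn; have := dim_socle; set X := limg r; set T := amull (r y).
have := limg_ker_dim T fullv; rewrite capfv.
suff: (\dim (limg T) < \dim (X + limg T)%VS)%N by lia.
by apply: nilpotent_dim_lt tn _; rewrite -(rmorph1 r) memv_img ?memvf.
Qed.

End GysinPair.

(** * The algebraic core in rank three *)

Section RankThree.
Local Open Scope ring_scope.
Variables (F : fieldType) (A B C : falgType F).
Variables (rA : 'AHom(A, B)) (z : A) (psiA : 'Hom(B, A)).
Variables (rB : 'AHom(B, C)) (x : B) (psiB : 'Hom(C, B)).
Hypotheses (exAB : gysin_pair rA z psiA) (exBC : gysin_pair rB x psiB).
Variables (y : B) (n : nat).
Hypotheses (xyC : x * y = y * x) (xn : x ^+ n = 0) (yn : y ^+ n = 0).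
Hypotheses (xA : x \in limg rA) (yA : y \in limg rA).
Hypothesis psiM : forall c, psiB (rB y * c) = y * psiB c.
Variable w : C.
Hypotheses (tw : rB y * w = 0) (psi_w : psiA (psiB w) != 0).

Let t := rB y.
Let M := limg rA.

Let memM m : (m \in M) = (psiA m == 0).
Proof. by rewrite /M -(gysin_pair_lker_psi exAB) memv_ker. Qed.

Let M_mul : {in M &, forall m m', m * m' \in M}.
Proof.
move=> _ _ /memv_imgP[a _ ->] /memv_imgP[a' _ ->].
by rewrite -rmorphM memv_img ?memvf.
Qed.

Let M_1 : 1 \in M.
Proof. by rewrite -(rmorph1 rA) memv_img ?memvf. Qed.

Let M_exp m k : m \in M -> m ^+ k \in M.
Proof.
move=> Mm; elim: k => [|k IHk]; first by rewrite expr0.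
by rewrite exprS M_mul.
Qed.

Let tn : t ^+ n = 0.
Proof. by rewrite -rmorphXn yn rmorph0. Qed.

Let M_socle : exists2 s, s \in M & (s \in socle x y) && (s != 0).
Proof.
have [i [k [yx0 yx_soc]]] := socle_monomial xyC xn yn.
by exists (y ^+ k * x ^+ i); rewrite ?yx0 ?yx_soc // M_mul ?M_exp.
Qed.

Let w_socle : psiB w \in socle x y.
Proof.
rewrite memv_socle -psiM tw linear0 eqxx andbT.
by case: exBC => _ _ exB; apply/eqP/exB; exists w.
Qed.

Let socle_free s : s \in M -> s != 0 -> \dim (<[s]> + <[psiB w]>)%VS = 2%N.
Proof.
move=> Ms s0; have psiw0 : psiB w != 0.
  by apply: contraNneq psi_w => ->; rewrite linear0.
rewrite dimv_disjoint_sum ?dim_vline ?s0 ?psiw0 //.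
apply/eqP; rewrite -subv0; apply/subvP => b; rewrite memv_cap memv0.
case/andP=> /vlineP[k1 ->] /vlineP[k2 def_b].
have: k1 *: s \in M by apply: memvZ.
rewrite def_b memM linearZ scaler_eq0 (negPf psi_w) orbF => /eqP->.
by rewrite scale0r.
Qed.

(** If [dim (ker t) <= 3], the socle is exactly the plane spanned by [s] and
    [psiB w].  An element of [X] lying in [t C] is [t c'] with [psiB c'] in the
    socle, so up to [t X] it is a multiple of [t c], as [t w = 0].  Thus [X] is
    generated over [t] by [1] and [t c = rB beta], hence [B] over [x] and [y] by
    [1] and [beta]. *)
Lemma rank_three_generators :
    (\dim (lker (amull t)) <= 3)%N ->
  exists c beta, t * c = rB beta /\
    forall b, b \in (M + amulr beta @: M)%VS.
Proof.
move=> t3; have [s Ms /andP[soc_s s0]] := M_socle.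
have dim2 := socle_free Ms s0.
have sub_soc : (<[s]> + <[psiB w]> <= socle x y)%VS.
  by rewrite subv_add -!memvE soc_s.
have s2 : \dim (socle x y) = 2%N.
  apply/eqP; rewrite eqn_leq -ltnS (leq_trans (dim_socle_lt exBC psiM tn) t3).
  by rewrite -dim2 dimvS.
have def_soc : socle x y = (<[s]> + <[psiB w]>)%VS.
  by apply/esym/eqP; rewrite eqEdim sub_soc s2 dim2.
have def_X : (limg rB + limg (amull t) = <[1 : C]> + limg (amull t))%VS.
  apply/esym/eqP; rewrite eqEdim addvS //=; last first.
    by apply/subvP => _ /vlineP[k ->]; rewrite memvZ // -(rmorph1 rB) memv_img ?memvf.
  rewrite -(leq_add2l 2) -[in X in (X <= _)%N]s2 (dim_socle exBC psiM).
  rewrite -(limg_ker_dim (amull t) fullv) capfv -/t.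
  apply: leq_trans (leq_add t3 (leqnn _)) _; rewrite (leq_add2l 2 _.+1).
  exact/(nilpotent_dim_lt tn)/memv_line.
have [_ _ exB2] := exBC; have [exB exC _] := exBC.
(* [c] lifts [s] along [psiB]; as [y s = 0], the product [t c] comes from [B]. *)
have [c def_s] : exists c, s = psiB c.
  by apply/exB2; move: soc_s; rewrite memv_socle => /andP[/eqP].
have [beta def_beta] : exists beta, t * c = rB beta.
  apply/exC; rewrite psiM -def_s.
  by move: soc_s; rewrite memv_socle => /andP[_ /eqP].
exists c, beta; split=> // b.
set U := (M + _)%VS.
have M_U m : m \in M -> m \in U by apply/subvP/addvSl.
have Mbeta_U m : m \in M -> m * beta \in U.
  move=> Mm; apply: (subvP (addvSr _ _)); rewrite -amulrE; exact: memv_img.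
have U_mul m u : m \in M -> u \in U -> m * u \in U.
  move=> Mm /memv_addP[m1 Mm1 [_ /memv_imgP[m2 Mm2 ->] ->]].
  rewrite amulrE mulrDr mulrA; apply: rpredD; first exact/M_U/M_mul.
  exact/Mbeta_U/M_mul.
(* [B = U + y B + x B]; nilpotency of [x], then of [y], removes the last terms. *)
have step b1 : exists2 u, u \in U & exists b2 b3, b1 = u + y * b2 + x * b3.
  have: rB b1 \in (<[1 : C]> + limg (amull t))%VS.
    by rewrite -def_X -[rB b1]addr0 memv_add ?mem0v ?memv_img ?memvf.
  case/memv_addP=> _ /vlineP[k ->] [_ /memv_imgP[c' _ ->]]; rewrite amullE => b1E.
  have tc'E : t * c' = rB (b1 - k%:A) by rewrite linearB /= b1E linearZ /= rmorph1 addrC addKr.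
  have : psiB c' \in socle x y.
    rewrite memv_socle; apply/andP; split; first by apply/eqP/exB2; exists c'.
    by rewrite -psiM; apply/eqP/exC; exists (b1 - k%:A).
  rewrite def_soc => /memv_addP[_ /vlineP[k1 ->] [_ /vlineP[k2 ->]]] psi_c'.
  have [b2 def_b2] : exists b2, c' - k1 *: c - k2 *: w = rB b2.
    apply/exC; rewrite !linearB !linearZ /= psi_c' def_s !scalerN -addrA -opprD; exact: subrr.
  have [b3 def_b3] : exists b3, b1 - k%:A - k1 *: beta - y * b2 = x * b3.
    apply/exB; rewrite 2!linearB /= -tc'E linearZ /= -def_beta rmorphM /= -def_b2 -/t.
    rewrite !mulrBr -!scalerAr tw scaler0 subr0; exact: subrr.
  exists (k%:A + k1 *: beta); last first.
    by exists b2, b3; rewrite -def_b3 [RHS]addrC -2!(addrA b1) -2!opprD subrK.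
  apply: rpredD; first exact/memvZ/M_U.
  by apply: memvZ; rewrite -[beta]mul1r; apply: Mbeta_U.
have U_y b1 : b1 \in (U + limg (amull y))%VS.
  apply: (nilpotent_nakayama xn) => [u|b2].
    move=> /memv_addP[u1 Uu1 [_ /memv_imgP[b2 _ ->] ->]].
    rewrite amullE mulrDr mulrA xyC -mulrA memv_add ?U_mul //.
    by rewrite -amullE memv_img ?memvf.
  have [u Uu [b3 [b4 ->]]] := step b2; exists (u + y * b3); last by exists b4.
  by rewrite memv_add // -amullE memv_img ?memvf.
apply: (nilpotent_nakayama yn) => [u|b1]; first exact: U_mul.
have /memv_addP[u Uu [_ /memv_imgP[b2 _ ->] ->]] := U_y b1.
by exists u => //; exists b2; rewrite amullE.
Qed.

(** A count of dimensions: [dim B = 2 dim M] leaves no room for a relation in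
    [B = M + M beta]. *)
Lemma amulr_lreg beta m :
    (forall b, b \in (M + amulr beta @: M)%VS) ->
  m \in M -> m * beta \in M -> m = 0.
Proof.
move=> genB Mm Mmb; have [dimB _] := gysin_pair_dim exAB.
have dim_sum : \dim (M + amulr beta @: M)%VS = (2 * \dim M)%N.
  by rewrite -dimB; congr (\dim _); apply/vspaceP => b; rewrite genB memvf.
have := dimv_sum_cap M (amulr beta @: M); have := limg_ker_dim (amulr beta) M.
rewrite dim_sum => dim_img dim_cap.
have/eqP: \dim (M :&: amulr beta @: M) = 0%N by lia.
rewrite dimv_eq0 => /eqP cap0.
have/eqP: \dim (M :&: lker (amulr beta)) = 0%N by lia.
rewrite dimv_eq0 => /eqP ker0.
have: m * beta \in (M :&: amulr beta @: M)%VS.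
  by rewrite memv_cap Mmb -amulrE memv_img.
rewrite cap0 memv0 -amulrE => mb0; apply/eqP.
by rewrite -memv0 -ker0 memv_cap Mm memv_ker.
Qed.

(** The contradiction comes from the ring structure of [C]: a power of [t] that is
    zero as an element also kills [c]. *)
Lemma rank_three_dim_gt : (3 < \dim (lker (amull t)))%N.
Proof.
rewrite ltnNge; apply/negP => /rank_three_generators[c [beta [tc genB]]].
have [exB _ _] := exBC.
have: exists e, y ^+ e \in limg (amull x) by exists n; rewrite yn mem0v.
move/ex_minnP => [[|e] /memv_imgP[b _ yeE] emin].
  by have := nilpotent_mul_neq1 b xn; rewrite -amullE -yeE expr0 eqxx.
have te0 : t ^+ e.+1 = 0.
  by rewrite -rmorphXn yeE; apply/exB; exists b; rewrite amullE.
have [b' def_b'] : exists b', y ^+ e * beta = x * b'.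
  by apply/exB; rewrite rmorphM rmorphXn /= -tc mulrA -exprSr te0 mul0r.
have /memv_addP[m1 Mm1 [_ /memv_imgP[m2 Mm2 ->] b'E]] := genB b'.
rewrite amulrE in b'E.
suff /eqP : y ^+ e - x * m2 = 0.
  rewrite subr_eq0 => /eqP ye; have := emin e; rewrite ltnn.
  by rewrite ye -amullE memv_img ?memvf // => /(_ isT).
apply: (amulr_lreg genB).
  by rewrite memvB ?M_exp ?M_mul.
by rewrite mulrBl def_b' b'E mulrDr mulrA addrK M_mul.
Qed.

End RankThree.

(** * Homogeneous components *)

Section GradedDecomposition.
Local Open Scope ring_scope.

Lemma gr_bound_le (K : gralg) n (v : K) : (gr_bound K <= n)%N -> v \in gr K n -> v = 0.
Proof. by move=> len; rewrite (gr_big len) memv0 => /eqP. Qed.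

Lemma sum_gr_bound (K : gralg) (v : nat -> K) N :
    (forall n, v n \in gr K n) -> (gr_bound K <= N)%N ->
  \sum_(n < N) v n = \sum_(n < gr_bound K) v n.
Proof.
move=> vgr leN; rewrite (big_ord_widen _ v leN) [RHS]big_mkcond /=.
by apply: eq_bigr => n _; case: ltnP => // len; apply: gr_bound_le len (vgr n).
Qed.

Lemma gr_decomp (K : gralg) (x : K) N : (gr_bound K <= N)%N ->
  exists2 v : nat -> K, forall n, v n \in gr K n & x = \sum_(n < N) v n.
Proof.
move=> leN; have: x \in (\sum_(n < gr_bound K) gr K n)%VS.
  by rewrite gr_full memvf.
case/memv_sumP=> v vgr ->.
pose u n := if insub n is Some i then v i else 0.
have uE (i : 'I_(gr_bound K)) : u i = v i by rewrite /u valK.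
have ugr n : u n \in gr K n.
  by rewrite /u; case: insubP => [i _ <-|_]; [exact: vgr | exact: mem0v].
by exists u; rewrite // sum_gr_bound //; apply: eq_bigr => i _; rewrite uE.
Qed.

(** The shift [s] serves for maps of positive degree such as [b |-> x * b]. *)
Lemma gr_indep (K : gralg) (v : nat -> K) N s :
    (forall n, v n \in gr K (n + s)%N) -> (gr_bound K <= N)%N ->
    \sum_(n < N) v n = 0 ->
  forall n, v n = 0.
Proof.
elim: s v N => [|s IHs] v N vgr leN sum0 n.
  have {}vgr m : v m \in gr K m by rewrite -[X in gr K X]addn0.
  have [len|ltn] := leqP (gr_bound K) n; first exact: gr_bound_le (vgr n).
  rewrite sum_gr_bound // in sum0.
  have /directv_sum_independent indep := gr_direct K.
  exact: (indep (fun i => v i) (fun i _ => vgr i) sum0 (Ordinal ltn)).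
pose u n := if n is m.+1 then v m else 0.
apply: (IHs u N.+1 _ _ _ n.+1) => [m||].
- case: m => [|m] /=; first exact: mem0v.
  by rewrite addSnnS.
- exact: leqW.
- by rewrite big_ord_recl add0r.
Qed.

(** Exactness on homogeneous elements extends to all elements; [P n] is the
    degree [n - p] part of [K], where [p] and [s] are the degrees of [f] and
    [g]. *)
Lemma graded_exactness (K L N : gralg) (f : {linear K -> L})
    (g : {linear L -> N}) (P : nat -> {vspace K}) p s :
    (forall n y, y \in gr K n -> f y \in gr L (n + p)%N /\ y \in P (n + p)%N) ->
    (forall n x, x \in gr L n -> g x \in gr N (n + s)%N) ->
    (forall n x, x \in gr L n ->
      (g x = 0 <-> exists2 y, y \in P n & x = f y)) ->
  forall x, g x = 0 <-> exists y, x = f y.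
Proof.
move=> f_gr g_gr exact_gr x; split=> [gx0|[y ->]].
  have [v vgr def_x] := gr_decomp x (leq_maxl (gr_bound L) (gr_bound N)).
  have gv0 : forall n, g (v n) = 0.
    apply: (gr_indep (s := s) _ (leq_maxr (gr_bound L) (gr_bound N))).
      by move=> n; apply: g_gr.
    by rewrite -linear_sum -def_x.
  pose S := (linfun f @: fullv)%VS.
  have: x \in S.
    rewrite def_x; apply: memv_suml => n _.
    have [/(_ (gv0 n))[y _ ->] _] := exact_gr _ _ (vgr n).
    by rewrite -[f y]lfunE memv_img ?memvf.
  by case/memv_imgP=> y _ ->; exists y; rewrite lfunE.
have [v vgr ->] := gr_decomp y (leqnn _); rewrite !linear_sum big1 //= => n _.
have [fv Pv] := f_gr _ _ (vgr n).
by apply/(exact_gr _ _ fv); exists (v n).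
Qed.

Lemma gr_exp (K : gralg) (x : K) n : x \in gr K 1 -> x ^+ n \in gr K n.
Proof.
move=> x1; elim: n => [|n IHn]; first by rewrite expr0 gr_one.
by rewrite exprS -[n.+1]/(1 + n)%N gr_mul.
Qed.

Lemma gr1_nilpotent (K : gralg) (x : K) N :
  x \in gr K 1 -> (gr_bound K <= N)%N -> x ^+ N = 0.
Proof. by move=> x1 leN; apply: gr_bound_le leN _; apply: gr_exp. Qed.

Lemma total_dimE (K : gralg) : total_dim K = \dim {:K}.
Proof.
by rewrite /total_dim -gr_full; apply/esym/eqP; rewrite (directvP (gr_direct K)).
Qed.

Lemma top_degree (K : gralg) :
  exists N, gr K N != 0%VS /\ gr K N.+1 = 0%VS.
Proof.
have ex0 : exists n, gr K n != 0%VS.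
  exists 0%N; apply/eqP => K0; have := gr_one K.
  by rewrite K0 memv0 oner_eq0.
have ub n : gr K n != 0%VS -> (n <= gr_bound K)%N.
  by apply: contraR; rewrite -ltnNge => /ltnW len; rewrite (gr_big len).
case: (ex_maxnP ex0 ub) => N KN Nmax; exists N; split=> //.
by apply: contraTeq isT => /Nmax; rewrite ltnn.
Qed.

End GradedDecomposition.

(** * Linear forms on elementary abelian 2-groups *)

Section LinearForms.
Local Open Scope ring_scope.

Lemma cohom_class_homog (gT : finGroupType) (G : {set gT})
    (l : {ffun gT -> ('F_2)^o}) : cohom_class G l \is 1.-homog.
Proof.
apply: rpred_sum => i _; apply: rpredZ.
by rewrite dhomogX /= mdeg1.
Qed.

Lemma homog1_cohom_class (gT : finGroupType) (G : {set gT}) (h : cohom G) :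
  h \is 1.-homog -> exists2 l, l \in H1 G & h = cohom_class G l.
Proof.
move=> h1; exists (\sum_(i < \dim (H1 G)) h@_U_(i) *: (vbasis (H1 G))`_i).
  by apply: memv_suml => i _; rewrite memvZ // vbasis_mem // mem_nth ?size_tuple.
have -> : cohom_class G (\sum_(i < \dim (H1 G)) h@_U_(i) *: (vbasis (H1 G))`_i) =
    \sum_(i < \dim (H1 G)) h@_U_(i) *: 'X_i.
  by apply: eq_bigr => i _; rewrite coord_sum_free // (basis_free (vbasisP _)).
apply/mpolyP => m; rewrite raddf_sum /=.
have [/mdeg1P[j /eqP->]|m1] := boolP (mdeg m == 1%N).
  rewrite (bigD1 j) //= big1 => [|i ij].
    by rewrite mcoeffZ mcoeffXU eqxx mulr1 addr0.
  by rewrite mcoeffZ mcoeffXU (negPf ij) mulr0.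
rewrite (dhomog_nemf_coeff h1 m1) big1 // => i _.
rewrite mcoeffZ mcoeffX; case: eqP => [mi|_]; last by rewrite mulr0.
by rewrite -mi mdeg1 in m1.
Qed.

Lemma cohom_map_homog1 (aT rT : finGroupType) (G : {group aT})
    (H : {group rT}) (f : aT -> rT) (h : cohom H) :
  h \is 1.-homog -> cohom_map G f h \is 1.-homog.
Proof.
by case/homog1_cohom_class=> l lH ->; rewrite cohom_mapE // cohom_class_homog.
Qed.

(** An element [w] of [W] outside [U] is an involution that commutes with [W], so
    [W = U * <w>] and [l] extends by [0] at [w]. *)
Lemma dual_extend (gT : finGroupType) (W U : {group gT})
    (l : {ffun gT -> ('F_2)^o}) :
    (2.-abelem W)%g -> U \subset W -> #|W : U|%g = 2%N -> l \in H1 U ->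
  exists2 l', l' \in H1 W & dual_map U id l' = l.
Proof.
move=> abW sUW iUW; rewrite mem_H1 => /is_dualP[l0 lM].
have [w Ww Uw] : exists2 w, w \in W & w \notin U.
  by apply/subsetPn; rewrite -indexg_eq1 iUW.
have [_ W2] := abelemP (isT : prime 2) abW.
have ww : (w * w = 1)%g by apply: W2.
have cW : {in W &, commutative mulg}.
  by move=> x y Wx Wy; apply: (centsP (abelem_abelian abW)).
have mulwU x : x \in W -> x \notin U -> (x * w)%g \in U.
  move=> Wx Ux; have -> : w = w^-1%g by rewrite -[RHS]mul1g -ww mulgK.
  rewrite -mem_rcoset; suff -> : (U :* w = W :\: U)%g by rewrite inE Ux.
  apply/eqP; rewrite eqEcard card_rcoset cardsD (setIidPr sUW) -(Lagrange sUW).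
  rewrite iUW muln2 -addnn addnK leqnn andbT.
  apply/subsetP => _ /rcosetP[u Uu ->].
  by rewrite inE groupMl // Uw groupM // (subsetP sUW).
pose l' : {ffun gT -> ('F_2)^o} :=
  [ffun x => if x \in U then l x else if x \in W then l (x * w)%g else 0].
exists l'; last first.
  by apply/ffunP => x; rewrite !ffunE /=; case: ifPn => [/=|nUx]; [move=> -> | rewrite l0].
rewrite mem_H1; apply/is_dualP; split=> [x Wx|x y Wx Wy].
  by rewrite ffunE (negPf Wx) (contraNF (subsetP sUW x) Wx).
rewrite !ffunE Wx Wy (groupM Wx Wy).
have [Ux|Ux] := boolP (x \in U); have [Uy|Uy] := boolP (y \in U).
- by rewrite groupM // lM.
- by rewrite groupMl // (negPf Uy) -mulgA lM ?mulwU.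
- by rewrite groupMr // (negPf Ux) -mulgA (cW y) // mulgA lM ?mulwU.
have xyE : (x * y = (x * w) * (y * w))%g.
  by rewrite (cW y) // -!mulgA (mulgA w) ww mul1g.
by rewrite xyE groupM ?mulwU // lM ?mulwU.
Qed.

Lemma cohom_restrict_homog1_surj (gT : finGroupType) (W U : {group gT})
    (h : cohom U) :
    (2.-abelem W)%g -> U \subset W -> #|W : U|%g = 2%N -> h \is 1.-homog ->
  exists2 h' : cohom W, h' \is 1.-homog & cohom_map U id h' = h.
Proof.
move=> abW sUW iUW /homog1_cohom_class[l lU ->].
have [l' l'W <-] := dual_extend abW sUW iUW lU.
by exists (cohom_class W l'); rewrite ?cohom_class_homog ?cohom_mapE.
Qed.

End LinearForms.

(** * Gysin functors *)

Section CohomAction.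
Local Open Scope ring_scope.
Variables (gT : finGroupType) (W : {group gT}) (K : cohom_alg W).

Definition act_class (h : cohom W) : K := co_act h 1.

Lemma co_act_class h (x : K) : co_act h x = act_class h * x.
Proof. by rewrite -[h in LHS]mulr1 -[x in LHS]mul1r co_actM co_act1. Qed.

Lemma act_class_commute h h' : act_class h * act_class h' = act_class h' * act_class h.
Proof. by rewrite -!co_act_class -!co_actA mulrC. Qed.

Lemma act_class_gr1 h : h \is 1.-homog -> act_class h \in gr K 1.
Proof. by move=> h1; apply: (co_act_gr h1 (gr_one K)). Qed.

End CohomAction.

Section GysinFunctor.
Local Open Scope ring_scope.
Variables (gT : finGroupType) (K : gysin_functor gT).

(** The Gysin sequence of [U < W] without gradings.  The last two clauses are the
    traces of the grading that serve to find a class of top degree. *)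
Lemma gysin_step (W U : {group gT}) (sUW : U \subset W) :
    #|W : U|%g = 2%N ->
  exists h : cohom W, exists psi : 'Hom(K U, K W),
    [/\ h \is 1.-homog,
        gysin_pair (linfun_ahom (gy_res K sUW)) (act_class (K W) h) psi,
        forall h' c, psi (act_class (K U) (cohom_map U id h') * c) =
                     act_class (K W) h' * psi c,
        forall n, gr (K W) n = 0%VS -> gr (K U) n = 0%VS
      & forall n b, b \in gr (K W) n -> act_class (K W) h * b = 0 ->
           exists2 c, c \in gr (K U) n & b = psi c].
Proof.
move=> iUW; have [t [psi [[t1 _] psi_gr resM psiM]]] := gy_exact K sUW iUW.
move=> [exB exC exB'].
set h := cohom_map W (coset U) t in exB exB'.
have h1 : h \is 1.-homog by apply: cohom_map_homog1.
have res_gr := gy_res_gr sUW.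
have mul_gr n b : b \in gr (K W) n -> act_class (K W) h * b \in gr (K W) (n + 1)%N.
  by move=> bn; rewrite addnC gr_mul ?act_class_gr1.
pose th : {linear K W -> K W} := act_class (K W) h \*o idfun.
exists h, (linfun psi); split=> //.
- split=> [b|c|b].
  + rewrite lfunE; apply: (@graded_exactness (K W) _ _ th (gy_res K sUW) (gr_pred (K W)) 1 0).
    * by move=> n y yn; split; [exact: mul_gr | by rewrite addn1].
    * by move=> n x xn; rewrite addn0; apply: res_gr.
    move=> n x xn; have [exB1 exB2] := exB n x xn; split.
      by case/exB1=> y yn ->; exists y; rewrite // co_act_class.
    by case=> y yn def_x; apply: exB2; exists y; rewrite // co_act_class.
  + have [|||ex1 ex2] := @graded_exactness (K W) (K U) (K W) (gy_res K sUW) psi (gr (K W)) 0 0 _ _ _ c.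
    * by move=> n y yn; rewrite addn0; split=> //; apply: res_gr.
    * by move=> n x xn; rewrite addn0; apply: psi_gr.
    * exact: exC.
    rewrite lfunE; split=> [/ex1[y ->]|[y def_c]]; first by exists y; rewrite lfunE.
    by apply: ex2; exists y; rewrite def_c lfunE.
  + have [|||ex1 ex2] := @graded_exactness (K U) (K W) (K W) psi th (gr (K U)) 0 1 _ _ _ b.
    * by move=> n y yn; rewrite addn0; split=> //; apply: psi_gr.
    * exact: mul_gr.
    * by move=> n x xn; rewrite -[th x]/(_ * x) -co_act_class; apply: exB'.
    split=> [/ex1[y ->]|[y def_b]]; first by exists y; rewrite lfunE.
    by apply: ex2; exists y; rewrite def_b lfunE.
- by move=> h' c; rewrite !lfunE /= -!co_act_class psiM.
- move=> n W0; apply/eqP; rewrite -subv0; apply/subvP => c cn; rewrite memv0.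
  have /(exC _ _ cn)[b] : psi c = 0.
    by apply/eqP; rewrite -memv0 -W0; apply: psi_gr.
  by rewrite W0 memv0 => /eqP-> ->; rewrite linear0.
move=> n b bn; rewrite -co_act_class => /(exB' _ _ bn)[c cn ->].
by exists c; rewrite ?lfunE.
Qed.

Lemma gy_res_act_class (W U : {group gT}) (sUW : U \subset W) (h : cohom W) :
    #|W : U|%g = 2%N ->
  gy_res K sUW (act_class (K W) h) = act_class (K U) (cohom_map U id h).
Proof.
move=> iUW; have [t [psi [_ _ resM _ _]]] := gy_exact K sUW iUW.
by rewrite resM rmorph1.
Qed.

Lemma total_dim_gysin (W U : {group gT}) (sUW : U \subset W) h psi :
    gysin_pair (linfun_ahom (gy_res K sUW)) (act_class (K W) h) psi ->
  total_dim (K U) = (2 * \dim (lker (amull (act_class (K W) h))))%N.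
Proof. by move=> exWU; rewrite total_dimE; have [] := gysin_pair_dim exWU. Qed.

Lemma rank_one_bound (U T : {group gT}) :
  T \subset U -> #|U : T|%g = 2%N -> (2 <= total_dim (K T))%N.
Proof.
move=> sTU iTU; have [h [psi [h1 exUT _ _ _]]] := gysin_step sTU iTU.
rewrite (total_dim_gysin exUT).
suff: \dim (lker (amull (act_class (K U) h))) != 0%N by lia.
rewrite dimv_eq0; apply/eqP => ker0.
have [k [tk ttk]] := last_nonzero_power (gr1_nilpotent (act_class_gr1 (K U) h1) (leqnn _)) (oner_neq0 (K U)).
by move/negP: tk; apply; rewrite -memv0 -ker0 memv_ker amullE ttk.
Qed.

(** Two successive Gysin sequences, [T < U] and [U < W]: the class of the first
    lifts to the action of a linear form [hy] on [W], and [psi] is linear for it. *)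
Lemma gysin_step2 (W U T : {group gT}) (sUW : U \subset W) :
    (2.-abelem W)%g -> T \subset U -> #|W : U|%g = 2%N -> #|U : T|%g = 2%N ->
  exists hx hy : cohom W, exists psi : 'Hom(K U, K W),
    let x := act_class (K W) hx in let y := act_class (K W) hy in
    let r := linfun_ahom (gy_res K sUW) in
    [/\ [/\ hx \is 1.-homog, hy \is 1.-homog
          & total_dim (K T) = (2 * \dim (lker (amull (r y))))%N],
        gysin_pair r x psi,
        forall c, psi (r y * c) = y * psi c,
        forall n, gr (K W) n = 0%VS -> gr (K U) n = 0%VS
      & forall n b, b \in gr (K W) n -> x * b = 0 ->
           exists2 c, c \in gr (K U) n & b = psi c].
Proof.
move=> abW sTU iUW iTU; have [h [psi [h1 exWU psiM vanish exgr]]] := gysin_step sUW iUW.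
have [g [phi [g1 exUT _ _ _]]] := gysin_step sTU iTU.
have [h' h'1 def_g] := cohom_restrict_homog1_surj abW sUW iUW g1.
have res_h' : linfun_ahom (gy_res K sUW) (act_class (K W) h') = act_class (K U) g.
  by rewrite lfunE /= gy_res_act_class // def_g.
exists h, h', psi; split=> //; first by rewrite res_h' (total_dim_gysin exUT).
by move=> c; rewrite res_h' -def_g psiM.
Qed.

Lemma rank_two_bound (W U T : {group gT}) :
    (2.-abelem W)%g -> U \subset W -> T \subset U ->
    #|W : U|%g = 2%N -> #|U : T|%g = 2%N ->
  (4 <= total_dim (K T))%N.
Proof.
move=> abW sUW sTU iUW iTU.
have [hx [hy [psi [[hx1 hy1 ->] exWU psiM _ _]]]] := gysin_step2 sUW abW sTU iUW iTU.
set x := act_class _ hx in exWU *; set y := act_class _ hy in psiM *.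
have nilp h : h \is 1.-homog -> act_class (K W) h ^+ gr_bound (K W) = 0.
  by move=> h1; apply: gr1_nilpotent (act_class_gr1 _ h1) (leqnn _).
have tn : linfun_ahom (gy_res K sUW) y ^+ gr_bound (K W) = 0.
  by rewrite -rmorphXn nilp // rmorph0.
apply: (@leq_mul 2 2 2 _ (leqnn 2)); apply: leq_ltn_trans (dim_socle_lt exWU psiM tn).
have [i [k [yx0 yx_soc]]] :=
  socle_monomial (act_class_commute (K W) hx hy) (nilp _ hx1) (nilp _ hy1).
by rewrite lt0n dimv_eq0; apply: contraNneq yx0 => soc0; rewrite -memv0 -soc0.
Qed.

(** In the top degree [N] of [K V], every class is killed by [z], hence comes from
    [K W], and degree [N.+1] vanishes in [K W] and [K U] too.  This gives the
    element [w]: it has degree [N], so [t] kills it. *)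
Lemma rank_three_bound (V W U T : {group gT}) :
    (2.-abelem V)%g -> W \subset V -> U \subset W -> T \subset U ->
    #|V : W|%g = 2%N -> #|W : U|%g = 2%N -> #|U : T|%g = 2%N ->
  (8 <= total_dim (K T))%N.
Proof.
move=> abV sWV sUW sTU iWV iUW iTU; have abW := abelemS sWV abV.
have [hz [psiA [hz1 exVW _ vanW exV]]] := gysin_step sWV iWV.
have [hx [hy [psi [[hx1 hy1 ->] exWU psiM vanU exW]]]] := gysin_step2 sUW abW sTU iUW iTU.
have lift h : h \is 1.-homog -> act_class (K W) h \in limg (linfun_ahom (gy_res K sWV)).
  case/(cohom_restrict_homog1_surj abV sWV iWV)=> h' _ <-.
  by rewrite -gy_res_act_class // -lfunE memv_img ?memvf.
have nilp h : h \is 1.-homog -> act_class (K W) h ^+ gr_bound (K W) = 0.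
  by move=> h1; apply: gr1_nilpotent (act_class_gr1 _ h1) (leqnn _).
have [N [VN V0]] := top_degree (K V).
have W0 := vanW _ V0; have U0 := vanU _ W0.
have mul_top (G : {group gT}) (L : cohom_alg G) h b : gr L N.+1 = 0%VS ->
    h \is 1.-homog -> b \in gr L N -> act_class L h * b = 0.
  move=> L0 h1 bN; apply/eqP; rewrite -memv0 -L0.
  exact: (gr_mul (act_class_gr1 _ h1) bN).
have [a aN a0] : exists2 a, a \in gr (K V) N & a != 0.
  by exists (vpick (gr (K V) N)); rewrite ?memv_pick ?vpick0.
have [b bN def_a] := exV _ _ aN (mul_top _ (K V) _ _ V0 hz1 aN).
have [w wN def_b] := exW _ _ bN (mul_top _ (K W) _ _ W0 hx1 bN).
have tw : linfun_ahom (gy_res K sUW) (act_class (K W) hy) * w = 0.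
  rewrite lfunE /= gy_res_act_class // mul_top //; exact: cohom_map_homog1.
have psi_w : psiA (psi w) != 0 by rewrite -def_b -def_a.
apply: (@leq_mul 2 4 2 _ (leqnn 2)).
have := rank_three_dim_gt exVW exWU (act_class_commute _ hx hy) (nilp _ hx1)
  (nilp _ hy1) (lift _ hx1) (lift _ hy1) psiM tw psi_w; exact.
Qed.

End GysinFunctor.


Lemma index2_subgroup (gT : finGroupType) (G : {group gT}) k :
    (2.-abelem G)%g -> 'r(G)%g = k.+1 ->
  exists H : {group gT}, [/\ H \subset G, #|G : H|%g = 2%N & 'r(H)%g = k].
Proof.
move=> abG rG; have pG := abelem_pgroup abG.
have cardG : #|G| = (2 ^ k.+1)%N.
  by rewrite -rG (rank_abelem abG) -p_part part_pnat_id.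
have [H [_ /normal_sub sHG cardH]] : exists H : {group gT},
    [/\ H \subset G, H <| G & #|H| = (2 ^ k)%N]%g.
  by apply: (normal_pgroup pG (normal_refl G)); rewrite cardG pfactorK.
exists H; split=> //; last by rewrite (rank_abelem (abelemS sHG abG)) cardH pfactorK.
by apply/eqP; rewrite -(eqn_pmul2l (cardG_gt0 H)) Lagrange // cardG cardH expnSr.
Qed.

Theorem theorem3p1 (gT : finGroupType) (abV : (2.-abelem [set: gT])%g)
    (K : gysin_functor gT) :
  [/\ 'r([set: gT])%g = 1 -> 2 <= total_dim (K 1%G),
      'r([set: gT])%g = 2 -> connected (K 1%G) -> 4 <= total_dim (K 1%G)
    & 'r([set: gT])%g = 3 -> biconnected (K 1%G) -> 8 <= total_dim (K 1%G)].
Proof.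
have rank0 (G : {group gT}) : 'r(G)%g = 0 -> G = 1%G.
  by move=> rG; apply/val_inj/eqP; rewrite -[_ == _]negbK -rank_gt0 rG.
split=> [r1|r2 _|r3 _].
- have [T [sTV iT /rank0 T1]] := index2_subgroup (G := [set: gT]%G) abV r1.
  rewrite -T1; exact: rank_one_bound sTV iT.
- have [U [sUV iU rU]] := index2_subgroup (G := [set: gT]%G) abV r2.
  have abU := abelemS sUV abV; have [T [sTU iT /rank0 T1]] := index2_subgroup abU rU.
  rewrite -T1; exact: rank_two_bound abV sUV sTU iU iT.
have [W [sWV iW rW]] := index2_subgroup (G := [set: gT]%G) abV r3.
have abW := abelemS sWV abV; have [U [sUW iU rU]] := index2_subgroup abW rW.
have abU := abelemS sUW abW; have [T [sTU iT /rank0 T1]] := index2_subgroup abU rU.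
rewrite -T1.
exact: rank_three_bound abV sWV sUW sTU iW iU iT.
Qed.
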